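(* Let $(X,d)$ be a complete metric space and $\phi:X\to(-\infty,\infty]$ a lower semi-continuous function with $D(\phi)\neq\emptyset$ such that, with respect to a family $\Gamma$ of minimal geodesics and for some $\lambda,K\in\mathbb{R}$, $\phi$ is $\lambda$-convex, the squared distance function is $K$-convex, the commutativity holds, and $\phi$ is coercive with constant $\tau_*(\phi)\in(0,\infty]$ (conditions (a)-(d) of the context). Fix an initial point $x_0\in D(\phi)$ and consider discrete solutions $\{x_{\boldsymbol{\tau}_i}^k\}_{k\ge 0}$ with $x_{\boldsymbol{\tau}_i}^0=x_0$ associated with a sequence of partitions $\{\mathscr{P}_{\boldsymbol{\tau}_i}\}_{i\in\mathbb{N}}$ of $[0,\infty)$ such that $|\boldsymbol{\tau}_i|<\tau_*(\phi)$ and $\lim_{i\to\infty}|\boldsymbol{\tau}_i|=0$. Then the interpolated curves $\bar{x}_{\boldsymbol{\tau}_i}:[0,\infty)\to X$ converge, as $i\to\infty$, to a curve $\xi:[0,\infty)\to X$ with $\xi(0)=x_0$, uniformly on each bounded interval $[0,T]$. In particular, the limit curve $\xi$ is independent of the choices of the sequence of partitions and of the discrete solutions.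
   Context: Setting. A minimal geodesic is a curve $\gamma:[0,1]\to X$ with $d(\gamma(s),\gamma(t))=|s-t|\,d(\gamma(0),\gamma(1))$ for all $s,t\in[0,1]$. $D(\phi):=X\setminus\phi^{-1}(\infty)$. $\lambda$ and $K$ may be negative. $\Gamma$ is a family of minimal geodesics in $X$ containing, for every $x,y\in X$, at least one minimal geodesic from $x$ to $y$, such that: (a) ($\lambda$-convexity of $\phi$) for every $\gamma\in\Gamma$ with $\gamma(0),\gamma(1)\in D(\phi)$ and every $t\in[0,1]$, $\phi(\gamma(t))\le(1-t)\phi(\gamma(0))+t\phi(\gamma(1))-\frac{\lambda}{2}(1-t)t\,d^2(\gamma(0),\gamma(1))$; (b) ($K$-convexity of the squared distance) for every $z\in X$, $\gamma\in\Gamma$, $t\in[0,1]$, $d^2(z,\gamma(t))\le(1-t)d^2(z,\gamma(0))+t\,d^2(z,\gamma(1))-\frac{K}{2}(1-t)t\,d^2(\gamma(0),\gamma(1))$; (c) (commutativity) for all $\gamma,\eta\in\Gamma$ with $\gamma(0)=\eta(0)=x$, $\gamma(1)=y$, $\eta(1)=z$, the following limits exist and agree: $\lim_{s\downarrow 0}\frac{d^2(\gamma(s),z)-d^2(x,z)}{s}=\lim_{t\downarrow 0}\frac{d^2(\eta(t),y)-d^2(x,y)}{t}$; (d) (coercivity) there is $\tau_*(\phi)\in(0,\infty]$ such that for all $x\in X$ and $\tau\in(0,\tau_*(\phi))$, $\phi_\tau(x):=\inf_{z\in X}\{\phi(z)+\frac{d^2(x,z)}{2\tau}\}>-\infty$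 and $J^\phi_\tau(x):=\{z\in X: \phi(z)+\frac{d^2(x,z)}{2\tau}=\phi_\tau(x)\}\neq\emptyset$. This setting includes the case where $(X,d)$ is a complete $\mathrm{CAT}(1)$-space with $\operatorname{diam}X<\pi/2$ and $\phi$ is lower semi-continuous and $\lambda$-convex along minimal geodesics ($\Gamma$ being all minimal geodesics; then (b) for some $K>0$, (c) and (d) hold). Discrete solutions. A partition is $\mathscr{P}_{\boldsymbol{\tau}}=\{0=t^0_{\boldsymbol{\tau}}<t^1_{\boldsymbol{\tau}}<\cdots\}$ with $t^k_{\boldsymbol{\tau}}\to\infty$; $\tau_k:=t^k_{\boldsymbol{\tau}}-t^{k-1}_{\boldsymbol{\tau}}$, $|\boldsymbol{\tau}|:=\sup_{k\ge1}\tau_k$. A discrete solution from $x_0\in D(\phi)$ associated with $\mathscr{P}_{\boldsymbol{\tau}}$ is a sequence with $x^0_{\boldsymbol{\tau}}=x_0$ and $x^k_{\boldsymbol{\tau}}\in J^\phi_{\tau_k}(x^{k-1}_{\boldsymbol{\tau}})$ (arbitrarily chosen) for $k\ge1$. Its interpolated curve is $\bar{x}_{\boldsymbol{\tau}}(0):=x_0$, $\bar{x}_{\boldsymbol{\tau}}(t):=x^k_{\boldsymbol{\tau}}$ for $t\in(t^{k-1}_{\boldsymbol{\tau}},t^k_{\boldsymbol{\tau}}]$. *)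

(* Defs.v *)
From HB Require Import structures.
From mathcomp Require Import all_boot all_order all_algebra.
From mathcomp Require Import all_classical all_reals all_analysis.

Set Implicit Arguments.
Unset Strict Implicit.
Unset Printing Implicit Defensive.

Import Order.TTheory GRing.Theory Num.Theory.
Import numFieldNormedType.Exports.

Local Open Scope classical_set_scope.
Local Open Scope ring_scope.

(* completeType carries a point; all spaces below contain an initial point, so
   this excludes only the empty space. *)
#[short(type="completeMetricType")]
HB.structure Definition CompleteMetric (K : numDomainType) :=
  { M of CompletePseudoMetric K M & Metric K M }.

Section Setting.
Context {R : realType} {X : metricType R}.
Implicit Types (phi : X -> \bar R) (g : R -> X) (Gam : set (R -> X)).

Definition effective_domain phi : set X := ~` (phi @^-1` [set +oo%E]).

(* Curves on [0, 1] are functions on R of which only the values on [0, 1] are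
   ever used. *)
Definition minimal_geodesic g : Prop :=
  forall s t : R, 0 <= s <= 1 -> 0 <= t <= 1 ->
    mdist (g s) (g t) = `|s - t| * mdist (g 0) (g 1).

Definition geodesic_family Gam : Prop :=
  Gam `<=` minimal_geodesic /\
  forall x y, exists2 g, Gam g & g 0 = x /\ g 1 = y.

Definition convex_along Gam (lambda : R) phi : Prop :=
  forall g, Gam g -> effective_domain phi (g 0) ->
    effective_domain phi (g 1) ->
  forall t : R, 0 <= t <= 1 ->
    (phi (g t) <= (1 - t)%:E * phi (g 0%R) + t%:E * phi (g 1%R)
       - (lambda / 2 * (1 - t) * t * mdist (g 0) (g 1) ^+ 2)%:E)%E.

Definition sqdist_convex_along Gam (K : R) : Prop :=
  forall z g, Gam g -> forall t : R, 0 <= t <= 1 ->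
    mdist z (g t) ^+ 2 <=
      (1 - t) * mdist z (g 0) ^+ 2 + t * mdist z (g 1) ^+ 2
      - K / 2 * (1 - t) * t * mdist (g 0) (g 1) ^+ 2.

Definition commutativity Gam : Prop :=
  forall g h x y z, Gam g -> Gam h ->
    g 0 = x -> h 0 = x -> g 1 = y -> h 1 = z ->
  exists l : R,
    ((mdist (g s) z ^+ 2 - mdist x z ^+ 2) / s @[s --> 0^'+] --> l) /\
    ((mdist (h t) y ^+ 2 - mdist x y ^+ 2) / t @[t --> 0^'+] --> l).

Definition penalized phi (tau : R) (x z : X) : \bar R :=
  (phi z + (mdist x z ^+ 2 / (2 * tau))%:E)%E.

Definition moreau_yosida phi (tau : R) (x : X) : \bar R :=
  ereal_inf (range (penalized phi tau x)).

Definition resolvent phi (tau : R) (x : X) : set X :=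
  [set z | penalized phi tau x z = moreau_yosida phi tau x].

Definition coercive phi (taustar : \bar R) : Prop :=
  (0 < taustar)%E /\
  forall x tau, 0 < tau -> (tau%:E < taustar)%E ->
    (-oo < moreau_yosida phi tau x)%E /\ resolvent phi tau x !=set0.

Definition is_partition (t : nat -> R) : Prop :=
  [/\ t 0%N = 0, (forall k, t k < t k.+1) & t k @[k --> \oo] --> +oo].

(* The supremum of the time steps; it may be infinite. *)
Definition mesh (t : nat -> R) : \bar R :=
  ereal_sup (range (fun k => (t k.+1 - t k)%:E)).

Definition discrete_solution phi (t : nat -> R) (x0 : X) (x : nat -> X) : Prop :=
  x 0%N = x0 /\ forall k, resolvent phi (t k.+1 - t k) (x k) (x k.+1).

(* No k satisfies the condition when s <= t 0 (for k = 0 it reads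
   t 0 < s <= t 0), in which case xget returns its default 0; see
   interpolation0 and interpolationE. *)
Definition interpolation (t : nat -> R) (x : nat -> X) (s : R) : X :=
  x (xget 0%N [set k | t k.-1 < s <= t k]).

Lemma partition_le t : is_partition t -> {homo t : m n / (m <= n)%N >-> m <= n}.
Proof.
by case=> _ tS _; apply: homo_leq => // [y x z|k]; [exact: le_trans|exact: ltW].
Qed.

Lemma interpolation0 t x : is_partition t -> interpolation t x 0 = x 0%N.
Proof.
move=> pt; have [t0 _ _] := pt; rewrite /interpolation; congr x.
case: xgetP => // k _ /= /andP[+ _]; rewrite ltNge => /negP[].
by rewrite -t0; exact: partition_le.
Qed.

Lemma interpolationE t x k s : is_partition t -> t k < s <= t k.+1 ->
  interpolation t x s = x k.+1.
Proof.
move=> pt /andP[ks sk]; rewrite /interpolation; congr x.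
have le_idx m n : t m < s -> s <= t n -> (m < n)%N.
  move=> ms sn; rewrite ltnNge; apply/negP => /(partition_le pt) nm.
  by have := lt_le_trans ms (le_trans sn nm); rewrite ltxx.
case: xgetP => [[|j] _ /= /andP[js sj]|/(_ k.+1)/=].
- by have := le_idx _ _ js sj; rewrite ltnn.
- by apply/eqP; rewrite eqn_leq (le_idx _ _ js sk) (le_idx _ _ ks sj).
- by rewrite ks sk => /(_ isT).
Qed.

End Setting.

(* Main.v *)
Require Import Defs.
From HB Require Import structures.
From mathcomp Require Import all_boot all_order all_algebra.
From mathcomp Require Import all_classical all_reals all_analysis.
From mathcomp Require Import ring lra.

(* Commutativity and the K-convexity of the squared distance turn minimality of
   a resolvent point z in J_tau(x) into a discrete evolution variational
   inequality: for every y in the domain,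
     (1 + lambda tau) d^2(z, y)
       <= d^2(x, y) + 2 tau (phi y - phi z) - K/2 d^2(x, z).
   The last term is summable, with a sum of order the mesh, because
   d^2(x, z) <= 2 tau (phi x - phi z).  Testing two discrete solutions against
   each other makes the energies cancel and leaves a two-index recursion for
   d^2(x_k, y_j) of Crandall-Liggett type; Kobayashi's supersolution
   sqrt((t_k - s_j)^2 + h (t_k + s_j)) bounds it by O(sqrt h) at times at
   distance at most h.  Hence discrete solutions are Cauchy as the mesh tends to
   0, whatever the partitions, and xi is the limit along uniform partitions. *)

Set Implicit Arguments.
Unset Strict Implicit.
Unset Printing Implicit Defensive.

Import Order.TTheory GRing.Theory Num.Theory.
Import numFieldNormedType.Exports.

Local Open Scope classical_set_scope.
Local Open Scope ring_scope.

(** * Real inequalities and recursions over partitions *)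

Section RealEstimates.
Context {R : realType}.
Implicit Types (t s p q : nat -> R).

(** Cauchy-Schwarz with unnormalised weights: the gap between [(p + q) * (p * a + q * b)] and the
    square of the left-hand side is [p * q * (Num.sqrt a - Num.sqrt b) ^+ 2]. *)
Lemma sqrt_concave (p q a b d : R) : 0 <= p -> 0 <= q -> 0 < p + q ->
    0 <= a -> 0 <= b -> p * a + q * b <= (p + q) * d ->
  p * Num.sqrt a + q * Num.sqrt b <= (p + q) * Num.sqrt d.
Proof.
move=> p0 q0 pq0 a0 b0 hd.
have d0 : 0 <= d.
  by rewrite -(pmulr_rge0 _ pq0) (le_trans _ hd)// addr_ge0 ?mulr_ge0.
have sqa := sqr_sqrtr a0; have sqb := sqr_sqrtr b0; have sqd := sqr_sqrtr d0.
have ra := sqrtr_ge0 a; have rb := sqrtr_ge0 b; have rd := sqrtr_ge0 d.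
rewrite -ler_sqr ?nnegrE ?addr_ge0 ?mulr_ge0 ?addr_ge0//.
apply: (@le_trans _ _ ((p + q) * (p * a + q * b))).
  rewrite -{2}sqa -{2}sqb -subr_ge0.
  have -> : (p + q) * (p * Num.sqrt a ^+ 2 + q * Num.sqrt b ^+ 2) -
     (p * Num.sqrt a + q * Num.sqrt b) ^+ 2 =
     p * q * (Num.sqrt a - Num.sqrt b) ^+ 2 by ring.
  by apply: mulr_ge0; [exact: mulr_ge0|exact: sqr_ge0].
by rewrite exprMn sqd expr2 -mulrA ler_wpM2l// ltW.
Qed.

Lemma le_sqrt_sqrD (r u : R) : 0 <= r -> 0 <= u -> r <= Num.sqrt (r ^+ 2 + u).
Proof.
by move=> r0 u0; rewrite -{1}(ger0_norm r0) -sqrtr_sqr ler_wsqrtr// lerDl.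
Qed.

(* The bound solves the recursion as a supersolution: averaging
   [(t - s)^2 + h (t + s)] over the two predecessors gains [p q] from the square
   and loses at least as much from the linear term; then use concavity of the
   square root. *)
Lemma double_index_estimate (b : nat -> nat -> R) t s (C h : R) (N M : nat) :
    t 0%N = 0 -> s 0%N = 0 -> 0 <= C ->
    (forall k, 0 < t k.+1 - t k <= h) ->
    (forall j, 0 < s j.+1 - s j <= h) ->
    (forall k, (k <= N)%N -> b k 0%N <= C * t k) ->
    (forall j, (j <= M)%N -> b 0%N j <= C * s j) ->
    (forall k j, ((s j.+1 - s j) + (t k.+1 - t k)) * b k.+1 j.+1 <=
      (s j.+1 - s j) * b k j.+1 + (t k.+1 - t k) * b k.+1 j) ->
  forall k j, (k <= N)%N -> (j <= M)%N ->
    b k j <= C * Num.sqrt ((t k - s j) ^+ 2 + h * (t k + s j)).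
Proof.
move=> t0 s0 C0 tS sS b0r b0l bS.
have h0 : 0 <= h by have /andP[] := tS 0%N; lra.
have t_ge0 k : 0 <= t k.
  by elim: k => [|k IH]; [rewrite t0|have /andP[] := tS k; lra].
have s_ge0 k : 0 <= s k.
  by elim: k => [|k IH]; [rewrite s0|have /andP[] := sS k; lra].
elim=> [|k IHk] j.
  move=> _ jM; apply: (le_trans (b0l _ jM)); rewrite ler_wpM2l//.
  by rewrite t0 sub0r sqrrN add0r le_sqrt_sqrD ?mulr_ge0.
elim: j => [|j IHj] kN jM.
  apply: (le_trans (b0r _ kN)); rewrite ler_wpM2l//.
  by rewrite s0 subr0 addr0 le_sqrt_sqrD ?mulr_ge0.
have /andP[p0 ph] := tS k; have /andP[q0 qh] := sS j.
have b1 := IHk j.+1 (ltnW kN) jM; have b2 := IHj kN (ltnW jM).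
have := bS k j.
set p := t k.+1 - t k in p0 ph *; set q := s j.+1 - s j in q0 qh *.
move=> bkj; have pq0 : 0 < q + p by lra.
rewrite -(ler_pM2l pq0); apply: (le_trans bkj).
apply: (@le_trans _ _ (C * (q * Num.sqrt ((t k - s j.+1) ^+ 2 + h * (t k + s j.+1))
   + p * Num.sqrt ((t k.+1 - s j) ^+ 2 + h * (t k.+1 + s j))))).
  by rewrite mulrDr lerD// mulrCA ler_wpM2l// ltW.
rewrite mulrCA ler_wpM2l// sqrt_concave// ?(ltW p0) ?(ltW q0)//.
- by rewrite addr_ge0 ?sqr_ge0// mulr_ge0// addr_ge0 ?t_ge0 ?s_ge0.
- by rewrite addr_ge0 ?sqr_ge0// mulr_ge0// addr_ge0 ?t_ge0 ?s_ge0.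
have -> : t k = t k.+1 - p by rewrite /p; ring.
have -> : s j = s j.+1 - q by rewrite /q; ring.
rewrite -subr_ge0.
set u := t _; set v := s _.
have -> : (q + p) * ((u - v) ^+ 2 + h * (u + v)) -
  (q * ((u - p - v) ^+ 2 + h * (u - p + v)) +
   p * ((u - (v - q)) ^+ 2 + h * (u + (v - q)))) =
   p * q * ((h - p) + (h - q)) by ring.
by apply: mulr_ge0; [apply: mulr_ge0; exact: ltW|lra].
Qed.

(** Since [expR (2 * x) >= 1 + 2 * x], it suffices that [(1 - x) * (1 + 2 * x) = 1 + x * (1 - 2 *
    x)]. *)
Lemma onem_expR_ge1 (x : R) : 0 <= x -> x <= 1 / 2 -> 1 <= (1 - x) * expR (2 * x).
Proof.
move=> x0 x1; have := expR_ge1Dx (2 * x); nra.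
Qed.

(** An implicit step divides by [1 - x] with [x = c * (t k.+1 - t k)], which costs at most a factor
    [expR (2 * x)]; the exponents telescope to [2 * c * t k]. *)
Lemma discrete_gronwall (Y t : nat -> R) (c : R) :
    t 0%N = 0 -> 0 <= Y 0%N ->
    (forall k, 0 <= c * (t k.+1 - t k) <= 1 / 2) ->
    (forall k, (1 - c * (t k.+1 - t k)) * Y k.+1 <= Y k) ->
  forall k, Y k <= expR (2 * c * t k) * Y 0%N.
Proof.
move=> t0 Y0 ct YS; elim=> [|k IH]; first by rewrite t0 mulr0 expR0 mul1r.
have /andP[c0 c1] := ct k; have := onem_expR_ge1 c0 c1.
have -> : 2 * c * t k.+1 = 2 * (c * (t k.+1 - t k)) + 2 * c * t k by ring.
rewrite expRD; set x := c * _ in c0 c1 *; set e := expR (2 * x).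
set e' := expR _ in IH *.
move=> xe; have x1 : 0 < 1 - x by lra.
rewrite -(ler_pM2l x1); apply: (le_trans (YS _)).
apply: (le_trans IH).
by rewrite -(mulrA e e') [leRHS]mulrA ler_peMl// mulr_ge0// expR_ge0.
Qed.

(* [decay L t] turns the factor [1 - L tau] of the evolution variational
   inequality into a weight; in the weighted inequality the time steps become
   those of [stretched L t]. *)
Definition decay (L : R) t k := \prod_(i < k) (1 - L * (t i.+1 - t i)).

Definition stretched (L : R) t k :=
  \sum_(i < k) (t i.+1 - t i) / (1 - L * (t i.+1 - t i)).

Lemma decayS L t k : decay L t k.+1 = decay L t k * (1 - L * (t k.+1 - t k)).
Proof. by rewrite /decay big_ord_recr. Qed.

Lemma stretchedB L t k : stretched L t k.+1 - stretched L t k =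
  (t k.+1 - t k) / (1 - L * (t k.+1 - t k)).
Proof. by rewrite /stretched big_ord_recr /= addrAC subrr add0r. Qed.

(** One cell of the two-index recursion: [a] is the new squared distance, [a1] and [a2] those with
    one index moved back, [delta] an energy gap. Weighting the inequalities by [q] and [p] cancels
    [delta]; multiplying by [P * Q] then absorbs [r] and [r'] into the steps [p / r] and [q / r'].
    The errors [e] and [f] survive because [P * Q], [r] and [r'] are at most 1. *)
Lemma weighted_recursion (P Q r r' p q a a1 a2 e f delta : R) :
    0 < P -> P <= 1 -> 0 < Q -> Q <= 1 -> 0 < r -> r <= 1 -> 0 < r' -> r' <= 1 ->
    0 < p -> 0 < q -> 0 <= e -> 0 <= f ->
    r * a <= a1 + 2 * p * delta + e ->
    r' * a <= a2 - 2 * q * delta + f ->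
  (q / r' + p / r) * (P * r * (Q * r') * a) <=
    q / r' * (P * (Q * r') * a1 + e) + p / r * (P * r * Q * a2 + f).
Proof.
move=> P0 P1 Q0 Q1 r0 r1 r'0 r'1 p0 q0 e0 f0 h1 h2.
have h3 : (q * r + p * r') * a <= (q * a1 + p * a2) + (q * e + p * f).
  have : q * (r * a) <= q * (a1 + 2 * p * delta + e) by rewrite ler_pM2l.
  have : p * (r' * a) <= p * (a2 - 2 * q * delta + f) by rewrite ler_pM2l.
  lra.
have PQ0 : 0 <= P * Q by rewrite mulr_ge0// ltW.
have PQ1 : P * Q <= 1 by rewrite mulr_ile1// ltW.
have -> : (q / r' + p / r) * (P * r * (Q * r') * a) =
    P * Q * ((q * r + p * r') * a).
  by field; rewrite !gt_eqF.
have -> : q / r' * (P * (Q * r') * a1 + e) + p / r * (P * r * Q * a2 + f) =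
    P * Q * (q * a1 + p * a2) + (q / r' * e + p / r * f).
  by field; rewrite !gt_eqF.
apply: (le_trans (ler_wpM2l PQ0 h3)); rewrite mulrDr lerD2l.
apply: (@le_trans _ _ (q * e + p * f)).
  by rewrite ler_piMl// addr_ge0// mulr_ge0// ltW.
by apply: lerD; apply: ler_wpM2r => //; rewrite ler_pdivlMr// ler_piMr// ltW.
Qed.

Section Weights.
Context (L h : R) (t : nat -> R) (t0 : t 0%N = 0) (L0 : 0 <= L).
Context (tS : forall k, 0 < t k.+1 - t k <= h) (Lh : L * h <= 1 / 2).

Lemma step_contraction k : 0 <= L * (t k.+1 - t k) <= 1 / 2.
Proof.
have /andP[p0 ph] := tS k; rewrite mulr_ge0 ?(ltW p0)//=.
by rewrite (le_trans _ Lh)// ler_wpM2l.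
Qed.

Lemma decay_gt0 k : 0 < decay L t k.
Proof.
elim: k => [|k IH]; first by rewrite /decay big_ord0.
by rewrite decayS mulr_gt0//; have /andP[] := step_contraction k; lra.
Qed.

Lemma decay_le1 k : decay L t k <= 1.
Proof.
elim: k => [|k IH]; first by rewrite /decay big_ord0.
rewrite decayS mulr_ile1 ?(ltW (decay_gt0 _))//.
all: by have /andP[] := step_contraction k; lra.
Qed.

(** Keeps the weights away from 0 on bounded time intervals, so that they can be divided out at the
    end. *)
Lemma decay_expR_ge1 k : 1 <= decay L t k * expR (2 * L * t k).
Proof.
elim: k => [|k IH]; first by rewrite t0 /decay big_ord0 mulr0 expR0 mulr1.
have /andP[c0 c1] := step_contraction k.
have -> : 2 * L * t k.+1 = 2 * L * t k + 2 * (L * (t k.+1 - t k)) by ring.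
by rewrite expRD decayS mulrACA mulr_ege1 ?onem_expR_ge1.
Qed.

Lemma stretched_step k : t k.+1 - t k <= stretched L t k.+1 - stretched L t k <=
  (1 + 2 * L * h) * (t k.+1 - t k).
Proof.
have /andP[c0 c1] := step_contraction k; have /andP[p0 ph] := tS k.
rewrite stretchedB.
set p := t k.+1 - t k in c0 c1 p0 ph *.
have r0 : 0 < 1 - L * p by lra.
rewrite ler_pdivlMr// ler_pdivrMr//; apply/andP; split.
  by rewrite ler_piMr ?(ltW p0)//; lra.
(* This product is [(1 + 2 * L * h) * p * (1 - L * p) - p], the upper bound with its denominator
   cleared. *)
have : 0 <= p * (L * (h - p) + L * h * (1 - 2 * (L * p))).
  apply: mulr_ge0; first exact: ltW.
  apply: addr_ge0; first by apply: mulr_ge0 => //; lra.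
  by apply: mulr_ge0; [apply: mulr_ge0 => //; lra|lra].
lra.
Qed.

Lemma stretched_ge k : t k <= stretched L t k.
Proof.
elim: k => [|k IH]; first by rewrite t0 /stretched big_ord0.
by have /andP[] := stretched_step k; lra.
Qed.

Lemma stretched_le k : stretched L t k <= (1 + 2 * L * h) * t k.
Proof.
elim: k => [|k IH]; first by rewrite t0 /stretched big_ord0 mulr0.
by have /andP[] := stretched_step k; lra.
Qed.

End Weights.

End RealEstimates.

(** * Resolvent points and the evolution variational inequality *)

Section Resolvent.
Context {R : realType} {X : metricType R}.
Context (phi : X -> \bar R) (phi_ninfty : forall x, phi x != -oo%E).

Lemma effective_domainE y : effective_domain phi y -> phi y = (fine (phi y))%:E.
Proof.
rewrite /effective_domain /=; have := phi_ninfty y.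
by case: (phi y) => // _ /(_ erefl).
Qed.

Lemma resolvent_le tau x z y : resolvent phi tau x z -> effective_domain phi y ->
  effective_domain phi z /\
  fine (phi z) + mdist x z ^+ 2 / (2 * tau) <=
    fine (phi y) + mdist x y ^+ 2 / (2 * tau).
Proof.
move=> zJ yD; have : (penalized phi tau x z <= penalized phi tau x y)%E.
  by rewrite zJ; apply: ereal_inf_lbound; exists y.
rewrite /penalized (effective_domainE yD).
(* An infinite [phi z] would make the infimum infinite, while the competitor [y] keeps it finite. *)
have zD : phi z = +oo%E -> False.
  move=> zoo; have := zJ; rewrite /resolvent /= /penalized zoo addye ?ltNyr// => /esym.
  suff : (moreau_yosida phi tau x < +oo)%E by move=> /[swap] ->; rewrite ltxx.
  apply: (@le_lt_trans _ _ (penalized phi tau x y)).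
    by apply: ereal_inf_lbound; exists y.
  by rewrite /penalized (effective_domainE yD) -EFinD ltry.
by rewrite (effective_domainE zD) -!EFinD lee_fin.
Qed.

(** The slope [c] makes room for the quadratic part of [(1 - s) * s] in the convexity inequalities:
    after division by [s] it is linear and vanishes in the limit. *)
Lemma cvg_at_right_affine_ge (q : R -> R) (l a c : R) :
    q s @[s --> 0^'+] --> l ->
    (forall s, 0 < s -> s < 1 -> a + c * s <= q s) ->
  a <= l.
Proof.
move=> ql aq.
have al : a + c * s @[s --> 0^'+] --> a + c * 0.
  apply: cvgD; first exact: cvg_cst.
  apply: cvgM; first exact: cvg_cst.
  exact/cvg_at_right_filter/cvg_id.
rewrite mulr0 addr0 in al; apply: (ler_cvg_to al ql).
near=> s; apply: aq; first by near: s; exact: nbhs_right_gt.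
by near: s; exact: nbhs_right_lt.
Unshelve. all: by end_near. Qed.

Context (Gam : set (R -> X)) (lambda K : R).
Context (Gam_geo : geodesic_family Gam) (phi_convex : convex_along Gam lambda phi).
Context (sqdist_convex : sqdist_convex_along Gam K) (Gam_comm : commutativity Gam).

(* Minimality of [z] along the geodesic from [z] to [y] bounds from below the
   derivative of [d^2(., x)] along it; commutativity turns this derivative into
   the one of [d^2(., y)] towards [x], which [K]-convexity bounds from above. *)
Lemma resolvent_evi tau x z y : 0 < tau ->
    resolvent phi tau x z -> effective_domain phi y ->
  (1 + lambda * tau) * mdist z y ^+ 2 <=
    mdist x y ^+ 2 + 2 * tau * (fine (phi y) - fine (phi z))
    - K / 2 * mdist x z ^+ 2.
Proof.
move=> tau0 zJ yD; have [zD _] := resolvent_le zJ yD.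
have [_ geo] := Gam_geo.
have [g gG [g0 g1]] := geo z y; have [h hG [h0 h1]] := geo z x.
have [l [gl hl]] := Gam_comm gG hG g0 h0 g1 h1.
have lge : 2 * tau * (fine (phi z) - fine (phi y)
    + lambda / 2 * mdist z y ^+ 2) <= l.
  apply: (@cvg_at_right_affine_ge _ _ _ (- tau * lambda * mdist z y ^+ 2) gl) => s s0 s1.
  have s01 : 0 <= s <= 1 by rewrite !ltW.
  have phig := phi_convex gG; rewrite g0 g1 in phig.
  have {}phig := phig zD yD s s01.
  rewrite (effective_domainE zD) (effective_domainE yD) in phig.
  (* The convexity bound on [phi (g s)] is finite, so [g s] is an admissible competitor. *)
  have gsD : effective_domain phi (g s).
    by rewrite /effective_domain /= => goo; move: phig; rewrite goo.
  rewrite (effective_domainE gsD) -!EFinM -!EFinD lee_fin in phig.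
  have [_] := resolvent_le zJ gsD.
  rewrite (metric_sym x z) (metric_sym x (g s)).
  set A := mdist z x ^+ 2; set B := mdist (g s) x ^+ 2.
  move=> min.
  have : A / (2 * tau) - B / (2 * tau) <=
    s * (fine (phi y) - fine (phi z)) - lambda / 2 * (1 - s) * s * mdist z y ^+ 2 by lra.
  rewrite -mulrBl ler_pdivrMr ?mulr_gt0// ler_pdivlMr//; lra.
(* An upper bound on [l], obtained by applying the one-sided limit lemma to the negated quotient. *)
have lle : - (mdist x y ^+ 2 - mdist z y ^+ 2 - K / 2 * mdist x z ^+ 2) <= - l.
  have hlN : - ((mdist (h t) y ^+ 2 - mdist z y ^+ 2) / t) @[t --> 0^'+] --> - l.
    exact: cvgN hl.
  apply: (@cvg_at_right_affine_ge _ _ _ (- (K / 2 * mdist x z ^+ 2)) hlN) => s s0 s1.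
  have s01 : 0 <= s <= 1 by rewrite !ltW.
  have := sqdist_convex y hG s01; rewrite h0 h1.
  rewrite !(metric_sym y) (metric_sym z x) /= => hs.
  rewrite -[leRHS]mulNr ler_pdivlMr//; lra.
have : 2 * tau * (fine (phi z) - fine (phi y) + lambda / 2 * mdist z y ^+ 2) <=
  mdist x y ^+ 2 - mdist z y ^+ 2 - K / 2 * mdist x z ^+ 2.
  by rewrite (le_trans lge)// -lerN2.
lra.
Qed.

End Resolvent.

(** * Energy along a single discrete solution *)

Section DiscreteSolutions.
Context {R : realType} {X : metricType R}.
Context (phi : X -> \bar R) (phi_ninfty : forall x, phi x != -oo%E).
Context (x0 : X) (x0_dom : effective_domain phi x0).
Implicit Types (t s : nat -> R) (x y : nat -> X).

(** Measured from [x0] so that along a discrete solution it starts at 0 and is nondecreasing; error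
    terms bounded by its increments then telescope. *)
Definition energy_drop x k := fine (phi x0) - fine (phi (x k)).

Lemma discrete_solution_dom t x k : discrete_solution phi t x0 x ->
  effective_domain phi (x k).
Proof.
move=> [xx0 xJ]; elim: k => [|k IH]; first by rewrite xx0.
by have [] := resolvent_le phi_ninfty (xJ k) IH.
Qed.

(** The previous point [x k] is the competitor in the minimality of [x k.+1]. *)
Lemma discrete_solution_energy t x k : is_partition t ->
    discrete_solution phi t x0 x ->
  mdist (x k) (x k.+1) ^+ 2 <=
    2 * (t k.+1 - t k) * (energy_drop x k.+1 - energy_drop x k).
Proof.
move=> [_ tS _] xsol; have xD : effective_domain phi (x k) := discrete_solution_dom xsol.
have [_ /(_ k) xJ] := xsol; have tau0 : 0 < t k.+1 - t k by rewrite subr_gt0.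
have [_] := resolvent_le phi_ninfty xJ xD.
rewrite mdistxx expr0n /= mul0r addr0 -lerBrDl ler_pdivrMr ?mulr_gt0//.
by rewrite /energy_drop; lra.
Qed.

Lemma energy_dropS t x k : is_partition t -> discrete_solution phi t x0 x ->
  energy_drop x k <= energy_drop x k.+1.
Proof.
move=> pt xsol; have := discrete_solution_energy k pt xsol.
have [_ /(_ k) tS _] := pt; rewrite -(subr_gt0 (t k)) in tS.
move=> /(le_trans (sqr_ge0 _)); rewrite pmulr_rge0 ?mulr_gt0//.
by rewrite subr_ge0.
Qed.

Lemma energy_drop0 t x : discrete_solution phi t x0 x -> energy_drop x 0 = 0.
Proof. by move=> [xx0 _]; rewrite /energy_drop xx0 subrr. Qed.

Lemma energy_drop_le t x j k : is_partition t -> discrete_solution phi t x0 x ->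
  (j <= k)%N -> energy_drop x j <= energy_drop x k.
Proof.
move=> pt xsol; apply: (@homo_leq _ _ (fun a b => a <= b)) => //.
  by move=> a b c; exact: le_trans.
by move=> i; exact: energy_dropS pt xsol.
Qed.

(* Discrete Gronwall for [d^2(x0, x k) - tau0 * energy_drop x k]. *)
Lemma energy_drop_bound t x (tau0 m : R) : is_partition t ->
    discrete_solution phi t x0 x -> 0 < tau0 ->
    (forall z, effective_domain phi z ->
      m <= fine (phi z) + mdist x0 z ^+ 2 / (2 * tau0)) ->
    (forall k, 8 * (t k.+1 - t k) <= tau0) ->
  forall k, energy_drop x k <=
    (fine (phi x0) - m) * (1 + expR (8 / tau0 * t k)).
Proof.
move=> pt xsol tau0_gt0 mle tS k; have [t0 tlt _] := pt.
set A := fine (phi x0) - m.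
have dropA j : 2 * tau0 * (energy_drop x j - A) <= mdist x0 (x j) ^+ 2.
  have := mle (x j) (discrete_solution_dom xsol).
  rewrite -lerBlDl ler_pdivlMr ?mulr_gt0//.
  by rewrite /energy_drop /A; lra.
(* By [dropA], [Y j] is at least half of [mdist x0 (x j) ^+ 2], so it controls the distance although
   the drop is subtracted. *)
pose Y j := mdist x0 (x j) ^+ 2 - tau0 * energy_drop x j + tau0 * A.
have xx0 : x 0%N = x0 by case: xsol.
have Y0 : Y 0%N = tau0 * A.
  by rewrite /Y (energy_drop0 xsol) xx0 mdistxx expr0n /= mulr0 subr0 add0r.
have YS j : (1 - 4 / tau0 * (t j.+1 - t j)) * Y j.+1 <= Y j.
  have h1 := discrete_solution_energy j pt xsol; have h2 := dropA j.+1.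
  have h3 := metric_triangle x0 (x j) (x j.+1).
  have w0 := mdist_ge0 x0 (x j); have w1 := mdist_ge0 x0 (x j.+1).
  have d0 := mdist_ge0 (x j) (x j.+1).
  have tau_gt0 : 0 < t j.+1 - t j by rewrite subr_gt0.
  move: h1 h2 h3 w0 w1 d0 tau_gt0; rewrite /Y.
  set u := mdist x0 (x j); set u' := mdist x0 (x j.+1); set d := mdist _ _.
  set e := energy_drop x j; set e' := energy_drop x j.+1.
  set tau := t j.+1 - t j => h1 h2 h3 u0 u0' d0 tau_gt0.
  (* If [d <= u'], square the triangle inequality [u' - d <= u]; otherwise [u' ^+ 2 <= u' * d]
     already suffices. *)
  have hu : u' ^+ 2 - u ^+ 2 <= 2 * u' * d.
    have [du|du] := leP d u'.
      have : 0 <= (u + d - u') * (u + u' - d) by apply: mulr_ge0; lra.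
      by have := sqr_ge0 d; lra.
    have : 0 <= u' * (d - u') by apply: mulr_ge0; lra.
    by have := sqr_ge0 u; have := mulr_ge0 u0' d0; lra.
  (* Young's inequality with the weight [tau0 / (2 * tau)] on [d ^+ 2], so that the energy estimate
     turns this term into [tau0 * (e' - e)], which [Y] absorbs. *)
  have young : 2 * u' * d <= tau0 * (e' - e) + 2 * tau / tau0 * u' ^+ 2.
    rewrite -(ler_pM2l tau0_gt0).
    have -> : tau0 * (tau0 * (e' - e) + 2 * tau / tau0 * u' ^+ 2) =
      tau0 ^+ 2 * (e' - e) + 2 * tau * u' ^+ 2 by field; exact: lt0r_neq0.
    rewrite -(ler_pM2l tau_gt0).
    have : tau0 ^+ 2 * d ^+ 2 <= tau0 ^+ 2 * (2 * tau * (e' - e)).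
      by rewrite ler_wpM2l ?sqr_ge0.
    have := sqr_ge0 (tau0 * d - 2 * tau * u'); lra.
  (* The remaining term of [young] is [4 / tau0 * tau] times half of [u' ^+ 2], and that half is at
     most [Y j.+1]: this fixes the Gronwall constant [4 / tau0]. *)
  have : 4 / tau0 * tau * (u' ^+ 2 / 2) <=
      4 / tau0 * tau * (u' ^+ 2 - tau0 * e' + tau0 * A).
    rewrite ler_wpM2l ?mulr_ge0 ?invr_ge0 ?(ltW tau0_gt0) ?(ltW tau_gt0)//; lra.
  lra.
have A0 : 0 <= A.
  have := mle _ x0_dom; rewrite mdistxx expr0n /= mul0r addr0 /A; lra.
have := @discrete_gronwall _ Y t (4 / tau0) t0 _ _ YS k.
rewrite Y0 mulr_ge0 ?(ltW tau0_gt0)// => /(_ isT) Yk.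
have {}Yk := Yk _.
have : Y k <= expR (2 * (4 / tau0) * t k) * (tau0 * A).
  apply: Yk => j; have tau_gt0 : 0 < t j.+1 - t j by rewrite subr_gt0.
  rewrite mulr_ge0 ?mulr_ge0 ?invr_ge0 ?(ltW tau0_gt0) ?(ltW tau_gt0)//=.
  by rewrite mulrAC ler_pdivrMr//; have := tS j; lra.
have -> : 2 * (4 / tau0) = 8 / tau0 by ring.
set E := expR _ => YE.
rewrite -(ler_pM2l tau0_gt0); have := dropA k; rewrite /Y in YE; lra.
Qed.

End DiscreteSolutions.

(** * Comparison of two discrete solutions with the same initial point *)

Section Comparison.
Context {R : realType} {X : metricType R}.
Context (phi : X -> \bar R) (phi_ninfty : forall x, phi x != -oo%E).
Context (Gam : set (R -> X)) (lambda K : R).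
Context (Gam_geo : geodesic_family Gam) (phi_convex : convex_along Gam lambda phi).
Context (sqdist_convex : sqdist_convex_along Gam K) (Gam_comm : commutativity Gam).
Context (x0 : X) (x0_dom : effective_domain phi x0).
Implicit Types (t s : nat -> R) (x y : nat -> X).

Local Notation L := `|lambda|.
Local Notation drop := (energy_drop phi x0).

(** Absolute values cover both signs of [lambda] and [K]. The curvature term is bounded through the
    energy estimate, with [h] in place of the step, so that the errors are increments of the single
    sequence [|K| * h * drop x k]. *)
Lemma discrete_solution_evi t x h z k : is_partition t ->
    discrete_solution phi t x0 x -> (forall k, t k.+1 - t k <= h) ->
    effective_domain phi z ->
  (1 - L * (t k.+1 - t k)) * mdist (x k.+1) z ^+ 2 <=
    mdist (x k) z ^+ 2
    + 2 * (t k.+1 - t k) * (drop x k.+1 - (fine (phi x0) - fine (phi z)))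
    + `|K| * h * (drop x k.+1 - drop x k).
Proof.
move=> pt xsol th zD; have [_ /(_ k) tS _] := pt.
rewrite -(subr_gt0 (t k)) in tS.
have [_ /(_ k) xJ] := xsol.
have := resolvent_evi phi_ninfty Gam_geo phi_convex sqdist_convex Gam_comm tS xJ zD.
have := discrete_solution_energy phi_ninfty x0_dom k pt xsol.
have := energy_dropS phi_ninfty x0_dom k pt xsol.
rewrite /energy_drop; have := th k.
set tau := t k.+1 - t k in tS *; set u := mdist (x k.+1) z.
set v := mdist (x k) (x k.+1) => tauh dropS en evi.
have h1 : - (L * tau) * u ^+ 2 <= lambda * tau * u ^+ 2.
  rewrite ler_wpM2r ?sqr_ge0// -mulNr ler_wpM2r ?(ltW tS)//.
  by rewrite lerNl -normrN ler_norm.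
have h2 : - (K / 2 * v ^+ 2) <= `|K| / 2 * v ^+ 2.
  rewrite -mulNr ler_wpM2r ?sqr_ge0// -mulNr ler_wpM2r// -normrN.
  exact: ler_norm.
have h3 : `|K| / 2 * v ^+ 2 <= `|K| / 2 * (2 * h *
    (fine (phi x0) - fine (phi (x k.+1)) - (fine (phi x0) - fine (phi (x k))))).
  rewrite ler_wpM2l ?mulr_ge0// (le_trans en)// ler_wpM2r ?subr_ge0//; lra.
lra.
Qed.

(** Boundary values for the two-index recursion: test the variational inequality with [x0] and sum.
    Monotonicity of the drop lets its latest value stand for all earlier ones. *)
Lemma decay_sqdist_start t x h k : is_partition t ->
    discrete_solution phi t x0 x -> (forall k, t k.+1 - t k <= h) ->
    L * h <= 1 / 2 ->
  decay L t k * mdist (x k) x0 ^+ 2 <= `|K| * h * drop x k + 2 * drop x k * t k.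
Proof.
move=> pt xsol th Lh; have [t0 tlt _] := pt.
have tS j : 0 < t j.+1 - t j <= h by rewrite subr_gt0 tlt th.
have [xx0 _] := xsol; have drop0 := energy_drop0 xsol.
elim: k => [|k IH].
  by rewrite xx0 mdistxx expr0n /= mulr0 drop0 !mulr0 mul0r addr0.
have /andP[tau0 tauh] := tS k.
have P0 := decay_gt0 (normr_ge0 _) tS Lh k.
have P1 := decay_le1 (normr_ge0 _) tS Lh k.
have dropS := energy_dropS phi_ninfty x0_dom k pt xsol.
have drop_ge0 : 0 <= drop x k.
  by rewrite -drop0 (energy_drop_le phi_ninfty x0_dom pt xsol).
have tk : 0 <= t k by rewrite -t0; exact: partition_le.
have evi := discrete_solution_evi k pt xsol th x0_dom.
rewrite subrr subr0 -(ler_pM2l P0) in evi; rewrite decayS -mulrA.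
set tau := t k.+1 - t k in tau0 tauh evi *; apply: (le_trans evi).
have h1 : decay L t k * (2 * tau * drop x k.+1) <= 2 * tau * drop x k.+1.
  by rewrite ler_piMl// !mulr_ge0 ?(ltW tau0)//; lra.
have h2 : decay L t k * (`|K| * h * (drop x k.+1 - drop x k)) <=
    `|K| * h * (drop x k.+1 - drop x k).
  rewrite ler_piMl// mulr_ge0 ?subr_ge0// mulr_ge0//; lra.
have h3 : 0 <= (drop x k.+1 - drop x k) * t k by rewrite mulr_ge0 ?subr_ge0.
have tauE : t k.+1 = t k + tau by rewrite /tau addrC subrK.
rewrite tauE; lra.
Qed.

(* The two evolution variational inequalities tested with each other, weighted
   by the other scheme's step, add up so that the energies cancel. *)
Lemma discrete_solutions_sqdist t s x y h B N M :
    is_partition t -> is_partition s ->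
    discrete_solution phi t x0 x -> discrete_solution phi s x0 y ->
    (forall k, t k.+1 - t k <= h) -> (forall k, s k.+1 - s k <= h) ->
    L * h <= 1 / 2 -> drop x N <= B -> drop y M <= B ->
  decay L t N * decay L s M * mdist (x N) (y M) ^+ 2 <=
    2 * `|K| * h * B + 2 * B *
    Num.sqrt ((stretched L t N - stretched L s M) ^+ 2
              + (1 + 2 * L * h) * h * (stretched L t N + stretched L s M)).
Proof.
move=> pt ps xsol ysol th sh Lh xB yB.
have [t0 tlt _] := pt; have [s0 slt _] := ps.
have tS j : 0 < t j.+1 - t j <= h by rewrite subr_gt0 tlt th.
have sS j : 0 < s j.+1 - s j <= h by rewrite subr_gt0 slt sh.
have L0 : 0 <= L by [].
have h0 : 0 <= h by have /andP[] := tS 0%N; lra.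
have [xx0 _] := xsol; have [yy0 _] := ysol.
have dropx0 := energy_drop0 xsol; have dropy0 := energy_drop0 ysol.
have B0 : 0 <= B.
  by rewrite (le_trans _ xB)// -dropx0 (energy_drop_le phi_ninfty x0_dom pt xsol).
pose E k := `|K| * h * drop x k; pose F k := `|K| * h * drop y k.
have E_ge0 k : 0 <= E k.
  by rewrite !mulr_ge0// -dropx0 (energy_drop_le phi_ninfty x0_dom pt xsol).
have F_ge0 k : 0 <= F k.
  by rewrite !mulr_ge0// -dropy0 (energy_drop_le phi_ninfty x0_dom ps ysol).
pose P := decay L t; pose Q := decay L s.
have P0 k : 0 < P k by exact: decay_gt0 L0 tS Lh k.
have Q0 k : 0 < Q k by exact: decay_gt0 L0 sS Lh k.
have P1 k : P k <= 1 by exact: decay_le1 L0 tS Lh k.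
have Q1 k : Q k <= 1 by exact: decay_le1 L0 sS Lh k.
(* Subtracting the accumulated errors [E] and [F] turns the recursion with error increments into a
   homogeneous one. *)
pose b k j := P k * Q j * mdist (x k) (y j) ^+ 2 - E k - F j.
have step (r : nat -> R) : r 0%N = 0 -> (forall j, 0 < r j.+1 - r j <= h) ->
    forall k, 0 < stretched L r k.+1 - stretched L r k <= (1 + 2 * L * h) * h.
  move=> r0 rS k; have /andP[r1 rh] := rS k.
  have /andP[a1 a2] := stretched_step L0 rS Lh k.
  rewrite (lt_le_trans r1 a1)/= (le_trans a2)// ler_wpM2l// addr_ge0//.
  by rewrite !mulr_ge0.
have bound := @double_index_estimate _ b (stretched L t) (stretched L s) (2 * B)
  ((1 + 2 * L * h) * h) N M.
have : b N M <= 2 * B * Num.sqrt ((stretched L t N - stretched L s M) ^+ 2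
    + (1 + 2 * L * h) * h * (stretched L t N + stretched L s M)).
  apply: bound => //.
  - by rewrite /stretched big_ord0.
  - by rewrite /stretched big_ord0.
  - by rewrite mulr_ge0.
  - exact: step.
  - exact: step.
  (* The drop is at most [B] up to index [N], and [t k <= stretched L t k]; hence the boundary
     constant [2 * B]. *)
  - move=> k kN; rewrite /b /P /Q yy0 {2}/decay big_ord0 mulr1.
    have := decay_sqdist_start k pt xsol th Lh.
    have : drop x k * t k <= B * stretched L t k.
      rewrite ler_pM ?(stretched_ge t0 L0 tS Lh)//.
      + by rewrite -dropx0 (energy_drop_le phi_ninfty x0_dom pt xsol).
      + by rewrite -t0; exact: partition_le.
      + by rewrite (le_trans _ xB)// (energy_drop_le phi_ninfty x0_dom pt xsol).
    by have := F_ge0 0%N; rewrite /E /F; lra.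
  - move=> j jM; rewrite /b /P /Q xx0 {1}/decay big_ord0 mul1r metric_sym.
    have := decay_sqdist_start j ps ysol sh Lh.
    have : drop y j * s j <= B * stretched L s j.
      rewrite ler_pM ?(stretched_ge s0 L0 sS Lh)//.
      + by rewrite -dropy0 (energy_drop_le phi_ninfty x0_dom ps ysol).
      + by rewrite -s0; exact: partition_le.
      + by rewrite (le_trans _ yB)// (energy_drop_le phi_ninfty x0_dom ps ysol).
    by have := E_ge0 0%N; rewrite /E /F; lra.
  (* The recursion for [b]: each variational inequality is tested with the new point of the other
     solution. *)
  move=> k j; rewrite !stretchedB.
  have /andP[p0 ph] := tS k; have /andP[q0 qh] := sS j.
  have yD : effective_domain phi (y j.+1) := discrete_solution_dom phi_ninfty x0_dom ysol.
  have xD : effective_domain phi (x k.+1) := discrete_solution_dom phi_ninfty x0_dom xsol.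
  have evx := discrete_solution_evi k pt xsol th yD.
  have evy := discrete_solution_evi j ps ysol sh xD.
  have dropxS : E k <= E k.+1.
    by rewrite ler_wpM2l ?mulr_ge0// (energy_dropS phi_ninfty x0_dom k pt xsol).
  have dropyS : F j <= F j.+1.
    by rewrite ler_wpM2l ?mulr_ge0// (energy_dropS phi_ninfty x0_dom j ps ysol).
  have /andP[_ r1] := step_contraction L0 tS Lh k.
  have /andP[_ r2] := step_contraction L0 sS Lh j.
  rewrite !(metric_sym (y _)) in evy.
  have w := @weighted_recursion _ (P k) (Q j) (1 - L * (t k.+1 - t k))
    (1 - L * (s j.+1 - s j)) (t k.+1 - t k) (s j.+1 - s j)
    (mdist (x k.+1) (y j.+1) ^+ 2) (mdist (x k) (y j.+1) ^+ 2)
    (mdist (x k.+1) (y j) ^+ 2) (E k.+1 - E k) (F j.+1 - F j)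
    (drop x k.+1 - drop y j.+1) (P0 k) (P1 k) (Q0 j) (Q1 j).
  rewrite /b /P /Q !decayS -/P -/Q.
  have s1 : 0 <= L * (t k.+1 - t k) by rewrite mulr_ge0// ltW.
  have s2 : 0 <= L * (s j.+1 - s j) by rewrite mulr_ge0// ltW.
  set p := t k.+1 - t k in w evx p0 ph r1 s1 *.
  set q := s j.+1 - s j in w evy q0 qh r2 s2 *.
  have ex : (1 - L * p) * mdist (x k.+1) (y j.+1) ^+ 2 <=
      mdist (x k) (y j.+1) ^+ 2 + 2 * p * (drop x k.+1 - drop y j.+1)
      + (E k.+1 - E k).
    by rewrite /E -mulrBr.
  have ey : (1 - L * q) * mdist (x k.+1) (y j.+1) ^+ 2 <=
      mdist (x k.+1) (y j) ^+ 2 - 2 * q * (drop x k.+1 - drop y j.+1)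
      + (F j.+1 - F j).
    rewrite /F -mulrBr; apply: (le_trans evy).
    by rewrite /energy_drop; lra.
  have {}w := w _ _ _ _ p0 q0 _ _ ex ey.
  have {}w := w ltac:(lra) ltac:(lra) ltac:(lra) ltac:(lra)
    ltac:(by rewrite subr_ge0) ltac:(by rewrite subr_ge0).
  lra.
have : E N <= `|K| * h * B by rewrite ler_wpM2l ?mulr_ge0.
have : F M <= `|K| * h * B by rewrite ler_wpM2l ?mulr_ge0.
rewrite /b /P /Q; lra.
Qed.

End Comparison.

(** * Estimates uniform over partitions on bounded time intervals *)

Section Convergence.
Context {R : realType} {X : metricType R}.
Context (phi : X -> \bar R) (phi_ninfty : forall x, phi x != -oo%E).
Context (Gam : set (R -> X)) (lambda K : R) (taustar : \bar R).
Context (Gam_geo : geodesic_family Gam) (phi_convex : convex_along Gam lambda phi).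
Context (sqdist_convex : sqdist_convex_along Gam K) (Gam_comm : commutativity Gam).
Context (phi_coercive : coercive phi taustar).
Context (x0 : X) (x0_dom : effective_domain phi x0).
Implicit Types (t s : nat -> R) (x y : nat -> X).

Local Notation L := `|lambda|.

Lemma coercive_small_step : exists2 tau : R, 0 < tau & (tau%:E < taustar)%E.
Proof.
have [+ _] := phi_coercive; case: taustar => [r| |] //.
  rewrite lte_fin => r0; exists (r / 2); first by rewrite divr_gt0.
  by rewrite lte_fin ltr_pdivrMr// ltr_pMr// ltr1n.
by move=> _; exists 1 => //; rewrite ltry.
Qed.

Lemma coercive_lower_bound : exists2 tau : R, 0 < tau &
  exists m : R, forall z, effective_domain phi z ->
    m <= fine (phi z) + mdist x0 z ^+ 2 / (2 * tau).
Proof.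
have [tau tau0 taus] := coercive_small_step.
have [_ /(_ x0 tau tau0 taus)[my _]] := phi_coercive.
exists tau => //; exists (fine (moreau_yosida phi tau x0)) => z zD.
have : (moreau_yosida phi tau x0 <= penalized phi tau x0 z)%E.
  by apply: ereal_inf_lbound; exists z.
rewrite /penalized (effective_domainE phi_ninfty zD) -EFinD.
by case: (moreau_yosida phi tau x0) my.
Qed.

(** The constants are chosen before the partitions and the solutions; this uniformity makes the
    limit independent of all choices. *)
Lemma discrete_solutions_close (T : R) : exists2 G : R, 0 <= G &
  exists2 h0 : R, 0 < h0 & forall t s x y h N M, 0 < h <= h0 ->
    is_partition t -> is_partition s ->
    discrete_solution phi t x0 x -> discrete_solution phi s x0 y ->
    (forall k, t k.+1 - t k <= h) -> (forall k, s k.+1 - s k <= h) ->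
    t N <= T -> s M <= T -> `|t N - s M| <= h ->
  mdist (x N) (y M) ^+ 2 <= G * Num.sqrt h.
Proof.
have [tau0 tau0_gt0 [m mle]] := coercive_lower_bound.
pose A := fine (phi x0) - m; pose B := A * (1 + expR (8 / tau0 * T)).
have A0 : 0 <= A.
  by have := mle _ x0_dom; rewrite mdistxx expr0n /= mul0r addr0 /A; lra.
have B0 : 0 <= B by rewrite mulr_ge0// addr_ge0// expR_ge0.
(* Chosen so that the expression under the root is at most [h * W]: the square uses [h ^+ 2 <= h],
   and [8 * T] comes from [2 * h * (4 * T)]. The sign of [T] is known only once [t N <= T] is
   available, hence the absolute value. *)
pose W := (1 + 2 * L * T) ^+ 2 + 8 * `|T|.
have W0 : 0 <= W by rewrite addr_ge0 ?sqr_ge0// mulr_ge0.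
pose e := expR (2 * L * T).
exists (e * e * (2 * `|K| * B + 2 * B * Num.sqrt W)).
  by rewrite mulr_ge0 ?addr_ge0 ?mulr_ge0 ?expR_ge0 ?sqrtr_ge0.
have L0 : 0 <= L by [].
(* The three bounds give [h <= 1], the step condition [8 * h <= tau0] of the energy bound, and
   [L * h <= 1 / 2]. *)
exists (Num.min 1 (Num.min (tau0 / 8) (1 / (2 * (L + 1))))).
  by rewrite !lt_min ltr01/= !divr_gt0// mulr_gt0// ltr_wpDl.
move=> t s x y h N M /andP[h0]; rewrite !le_min => /and3P[h1 htau hL].
move=> pt ps xsol ysol th sh tT sT tsh.
have {htau} htau : 8 * h <= tau0 by move: htau; rewrite ler_pdivlMr//; lra.
have {hL} Lh : L * h <= 1 / 2.
  by move: hL; rewrite ler_pdivlMr ?mulr_gt0 ?ltr_wpDl//; lra.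
have [t0 tlt _] := pt; have [s0 slt _] := ps.
have tS j : 0 < t j.+1 - t j <= h by rewrite subr_gt0 tlt th.
have sS j : 0 < s j.+1 - s j <= h by rewrite subr_gt0 slt sh.
have tN0 : 0 <= t N by rewrite -t0; exact: partition_le.
have sM0 : 0 <= s M by rewrite -s0; exact: partition_le.
have T0 : 0 <= T by exact: le_trans tT.
have drop_le r z k : is_partition r -> discrete_solution phi r x0 z ->
    (forall k, r k.+1 - r k <= h) -> r k <= T -> energy_drop phi x0 z k <= B.
  move=> pr zsol rh rT.
  apply: (le_trans (energy_drop_bound phi_ninfty x0_dom pr zsol tau0_gt0 mle _ k)).
    by move=> j; have := rh j; lra.
  rewrite /B ler_wpM2l// lerD2l ler_expR ler_wpM2l//.
  by rewrite divr_ge0// ltW.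
have e_ge r k : r 0%N = 0 -> (forall j, 0 < r j.+1 - r j <= h) -> r k <= T ->
    1 <= decay L r k * e.
  move=> r0 rS rT; apply: (le_trans (decay_expR_ge1 r0 L0 rS Lh k)).
  by rewrite ler_wpM2l ?(ltW (decay_gt0 L0 rS Lh k))// ler_expR ler_wpM2l// mulr_ge0.
have := discrete_solutions_sqdist phi_ninfty Gam_geo phi_convex sqdist_convex
  Gam_comm x0_dom pt ps xsol ysol th sh Lh
  (drop_le _ _ _ pt xsol th tT) (drop_le _ _ _ ps ysol sh sT).
set Z := _ ^+ 2 + _ => close.
have sh0 : 0 <= Num.sqrt h by exact: sqrtr_ge0.
have ZW : Z <= h * W.
  rewrite /Z.
  have := stretched_ge t0 L0 tS Lh N; have := stretched_ge s0 L0 sS Lh M.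
  have := stretched_le t0 L0 tS Lh N; have := stretched_le s0 L0 sS Lh M.
  set u := stretched L t N; set v := stretched L s M => v1 u1 v0 u0.
  have Lh0 : 0 <= L * h by rewrite mulr_ge0// ltW.
  have c1 : L * h * t N <= L * h * T by rewrite ler_wpM2l.
  have c2 : L * h * s M <= L * h * T by rewrite ler_wpM2l.
  have tsh1 := le_trans (ler_norm _) tsh.
  have tsh2 : s M - t N <= h.
    by rewrite (le_trans _ tsh)// -opprB -normrN ler_norm.
  have uv : (u - v) ^+ 2 <= (h * (1 + 2 * L * T)) ^+ 2.
    rewrite -[(u - v) ^+ 2]real_normK ?num_real// ler_sqr ?nnegrE//; last first.
      by rewrite mulr_ge0 ?(ltW h0)// addr_ge0// !mulr_ge0.
    by rewrite ler_norml; apply/andP; split; lra.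
  have h2 : h ^+ 2 * (1 + 2 * L * T) ^+ 2 <= h * (1 + 2 * L * T) ^+ 2.
    by rewrite ler_wpM2r ?sqr_ge0// expr2 ler_piMr// ltW.
  have u2 : u <= 2 * T.
    apply: (le_trans u1).
    have : 2 * L * h * t N <= 1 * t N by rewrite ler_wpM2r//; lra.
    lra.
  have v2 : v <= 2 * T.
    apply: (le_trans v1).
    have : 2 * L * h * s M <= 1 * s M by rewrite ler_wpM2r//; lra.
    lra.
  have h3 : (1 + 2 * L * h) * h * (u + v) <= 2 * h * (4 * T).
    apply: ler_pM; [|lra| |lra].
      by apply: mulr_ge0; [lra|exact: ltW].
    by rewrite ler_wpM2r ?(ltW h0)//; lra.
  rewrite exprMn in uv; rewrite /W (ger0_norm T0); lra.
have sZ : Num.sqrt Z <= Num.sqrt h * Num.sqrt W.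
  by rewrite -sqrtrM ?(ltW h0)// ler_wsqrtr.
have hsh : h <= Num.sqrt h.
  rewrite -{1}(sqr_sqrtr (ltW h0)) expr2 ler_piMr//.
  by rewrite -sqrtr1 ler_wsqrtr.
have bnd : decay L t N * decay L s M * mdist (x N) (y M) ^+ 2 <=
    (2 * `|K| * B + 2 * B * Num.sqrt W) * Num.sqrt h.
  apply: (le_trans close).
  have : 2 * `|K| * B * h <= 2 * `|K| * B * Num.sqrt h.
    by rewrite ler_wpM2l// !mulr_ge0.
  have : 2 * B * Num.sqrt Z <= 2 * B * (Num.sqrt h * Num.sqrt W).
    by rewrite ler_wpM2l// mulr_ge0.
  lra.
have : 1 <= (decay L t N * e) * (decay L s M * e).
  by rewrite mulr_ege1// e_ge.
move=> /(ler_wpM2r (sqr_ge0 (mdist (x N) (y M)))); rewrite mul1r => /le_trans; apply.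
have : e * e * (decay L t N * decay L s M * mdist (x N) (y M) ^+ 2) <=
   e * e * ((2 * `|K| * B + 2 * B * Num.sqrt W) * Num.sqrt h).
  by rewrite ler_wpM2l// mulr_ge0// expR_ge0.
lra.
Qed.

Lemma partition_cover t u : is_partition t -> 0 < u ->
  exists k, t k < u <= t k.+1.
Proof.
move=> [t0 _ toy] u0; have ex : exists n, u <= t n.
  by have /cvgryPge/(_ u)[n _ /(_ n (leqnn n))] := toy; exists n.
case: (ex_minnP ex) => [[|k]]; first by rewrite t0 leNgt u0.
move=> uk kmin; exists k; rewrite uk andbT ltNge.
by apply/negP => /kmin; rewrite ltnn.
Qed.

Lemma interpolations_close (T eps : R) : 0 < eps ->
  exists2 delta : R, 0 < delta & forall t s x y,
    is_partition t -> is_partition s ->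
    discrete_solution phi t x0 x -> discrete_solution phi s x0 y ->
    (forall k, t k.+1 - t k <= delta) -> (forall k, s k.+1 - s k <= delta) ->
  forall u, 0 <= u <= T -> mdist (interpolation t x u) (interpolation s y u) <= eps.
Proof.
(* The grid point to the right of a time [u <= T] may exceed [T], but by at most 1. *)
move=> eps0; have [G G0 [h0 h0_gt0 close]] := discrete_solutions_close (T + 1).
(* With [delta <= c ^+ 2], the bound [G * Num.sqrt delta] is at most [(G + 1) * c = eps ^+ 2]. *)
pose c := eps ^+ 2 / (G + 1).
have G1 : 0 < G + 1 by rewrite ltr_wpDl.
have c0 : 0 < c by rewrite divr_gt0// exprn_gt0.
exists (Num.min (Num.min 1 h0) (c ^+ 2)).
  by rewrite !lt_min ltr01 h0_gt0 exprn_gt0.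
set d := Num.min _ _ => t s x y pt ps xsol ysol th sh u /andP[u0 uT].
have [d1 dh0 dc] : [/\ d <= 1, d <= h0 & d <= c ^+ 2].
  by rewrite /d !ge_min !lexx !orbT.
have [xx0 _] := xsol; have [yy0 _] := ysol.
move: u0; rewrite le_eqVlt => /predU1P[<-|u0].
  by rewrite !interpolation0// xx0 yy0 mdistxx ltW.
have [k ku] := partition_cover pt u0; have [j ju] := partition_cover ps u0.
rewrite (interpolationE _ pt ku) (interpolationE _ ps ju).
have /andP[k1 k2] := ku; have /andP[j1 j2] := ju.
have := th k; have := sh j => shj thk.
have d0 : 0 < d by rewrite !lt_min ltr01 h0_gt0 exprn_gt0.
have := close t s x y d k.+1 j.+1 _ pt ps xsol ysol th sh _ _ _.
rewrite d0 dh0 => /(_ isT) /(_ ltac:(lra)) /(_ ltac:(lra)).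
(* Both right endpoints lie between [u] and [u + d]. *)
have -> : `|t k.+1 - s j.+1| <= d.
  by rewrite ler_norml; apply/andP; split; lra.
move=> /(_ isT) xy.
rewrite -ler_sqr ?nnegrE ?mdist_ge0 ?(ltW eps0)//; apply: (le_trans xy).
have sd : Num.sqrt d <= c.
  by rewrite -[leRHS](ger0_norm (ltW c0)) -sqrtr_sqr ler_wsqrtr.
apply: (@le_trans _ _ ((G + 1) * c)).
  by rewrite ler_pM ?sqrtr_ge0// lerDl.
by rewrite /c mulrC divfK// gt_eqF.
Qed.

Lemma discrete_solution_exists t : is_partition t ->
    (forall k, (t k.+1 - t k)%:E < taustar)%E ->
  exists x, discrete_solution phi t x0 x.
Proof.
move=> [_ tlt _] tS; have [_ J] := phi_coercive.
pose x := fix x k := if k is k'.+1 then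
  xget x0 (resolvent phi (t k'.+1 - t k') (x k')) else x0.
exists x; split=> // k /=; apply: xgetPex.
by have [] := J (x k) (t k.+1 - t k) _ (tS k); rewrite ?subr_gt0.
Qed.

Lemma uniform_partition (h : R) : 0 < h -> is_partition (fun k => k%:R * h).
Proof.
move=> h0; split=> [|k|]; first by rewrite mul0r.
- by rewrite ltr_pM2r// ltr_nat.
- apply/cvgryPge => A; near=> k; rewrite -ler_pdivrMr//.
  by near: k; exact: nbhs_infty_ger.
Unshelve. all: by end_near. Qed.

End Convergence.

(** * Construction of the limit curve and convergence to it *)

Theorem theorem4p4 (R : realType) (X : completeMetricType R)
    (phi : X -> \bar R) (Gam : set (R -> X)) (lambda K : R) (taustar : \bar R)
    (phi_ninfty : forall x, phi x != -oo%E)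
    (phi_lsc : lower_semicontinuous phi)
    (phi_proper : effective_domain phi !=set0)
    (Gam_geo : geodesic_family Gam)
    (phi_convex : convex_along Gam lambda phi)
    (sqdist_convex : sqdist_convex_along Gam K)
    (Gam_comm : commutativity Gam)
    (phi_coercive : coercive phi taustar)
    (x0 : X) (x0_dom : effective_domain phi x0) :
  exists xi : R -> X,
    xi 0 = x0 /\
    forall (t : nat -> nat -> R) (x : nat -> nat -> X),
      (forall i, is_partition (t i)) ->
      (forall i, discrete_solution phi (t i) x0 (x i)) ->
      (forall i, (mesh (t i) < taustar)%E) ->
      mesh (t i) @[i --> \oo] --> 0%E ->
      forall T : R,
        {uniform `[0, T], interpolation (t i) (x i) @[i --> \oo] --> xi}.

Proof.
have [tau0 tau0_gt0 taus] := coercive_small_step phi_coercive.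
(* All uniform steps stay at most [tau0], below [taustar], so the resolvents are nonempty and the
   reference solutions exist. *)
pose h n : R := tau0 * n.+1%:R^-1.
have h0 n : 0 < h n by rewrite mulr_gt0 ?invr_gt0.
have htau n : h n <= tau0 by rewrite ler_piMr ?(ltW tau0_gt0)// invf_le1// ler1n.
pose r n k : R := k%:R * h n.
have rS n k : r n k.+1 - r n k = h n by rewrite /r -mulrBl -natrB// subSnn mul1r.
have pr n : is_partition (r n) := uniform_partition (h0 n).
have rsol n : exists x, discrete_solution phi (r n) x0 x.
  apply: (discrete_solution_exists phi_coercive x0 (pr n)) => k.
  by rewrite rS (le_lt_trans _ taus)// lee_fin.
have [z zsol] := choice rsol.
have h_small (d : R) : 0 < d -> \forall n \near \oo, h n <= d.
  move=> d0; near=> n; rewrite /h ler_pdivrMr// -ler_pdivrMl//.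
  rewrite (@le_trans _ _ n%:R) ?ler_nat//.
  by near: n; exact: nbhs_infty_ger.
have close (T eps : R) : 0 < eps -> exists2 delta : R, 0 < delta & forall n t x,
    h n <= delta -> is_partition t -> discrete_solution phi t x0 x ->
    (forall k, t k.+1 - t k <= delta) -> forall u : R, 0 <= u <= T ->
    mdist (interpolation (r n) (z n) u) (interpolation t x u) <= eps.
  move=> eps0; have [delta d0 hd] := interpolations_close phi_ninfty Gam_geo
    phi_convex sqdist_convex Gam_comm phi_coercive x0_dom T eps0.
  exists delta => // n t x hn pt xsol tS; apply: hd => // k.
  by rewrite rS.
(* The condition [0 <= u] stands under the existential so that [choice] yields a curve on all of
   [R], with arbitrary values at negative times. *)
have cvg_base (u : R) : exists l : X, 0 <= u ->
    interpolation (r n) (z n) u @[n --> \oo] --> l.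
  have [u0|u0] := leP 0 u; last by exists x0.
  suff /cauchy_cvg/cvg_ex[l ul] :
    cauchy (interpolation (r n) (z n) u @[n --> \oo]) by exists l.
  apply: cauchy_exP => eps eps0.
  have [delta d0 hd] := close u (eps / 2) (divr_gt0 eps0 (ltr0Sn _ 1)).
  have [N _ hN] := h_small _ d0.
  exists (interpolation (r N) (z N) u).
  suff : \forall n \near \oo,
    ball (interpolation (r N) (z N) u) eps (interpolation (r n) (z n) u) by [].
  near=> n.
  rewrite /= ballEmdist /=; apply: (@le_lt_trans _ _ (eps / 2)); last first.
    by rewrite ltr_pdivrMr// ltr_pMr// ltr1n.
  apply: (hd N _ _ (hN _ (leqnn N)) (pr n) (zsol n)); last by rewrite u0 lexx.
  by move=> k; rewrite rS; near: n; exact: h_small.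
have [xi xi_lim] := choice cvg_base.
(* Let the reference index grow in [close]: the distance is below [eps / 3 + eps / 3], uniformly in
   [u] because [delta] is chosen before [u]. *)
have xi_close (T eps : R) : 0 < eps -> exists2 delta : R, 0 < delta & forall t x,
    is_partition t -> discrete_solution phi t x0 x ->
    (forall k, t k.+1 - t k <= delta) -> forall u : R, 0 <= u <= T ->
    mdist (xi u) (interpolation t x u) < eps.
  move=> eps0; have e30 : 0 < eps / 3 by rewrite divr_gt0.
  have [delta d0 hd] := close T (eps / 3) e30.
  exists delta => // t x pt xsol tS u uT; have /andP[u0 _] := uT.
  have [N _ hN] := h_small _ d0.
  have [M _ hM] := metricType_numDomainType.cvgr_dist_lt (xi_lim u u0) e30.
  apply: (le_lt_trans (metric_triangle _ (interpolation (r (N + M)) (z (N + M)) u) _)).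
  have := hM (N + M)%N (leq_addl _ _).
  have := hd (N + M)%N t x (hN _ (leq_addr _ _)) pt xsol tS u uT.
  rewrite /=; lra.
exists xi; split.
  have base0 : interpolation (r n) (z n) 0 @[n --> \oo] --> x0.
    rewrite (_ : (fun n => _) = cst x0); first exact: cvg_cst.
    by apply/funext => n; rewrite interpolation0//; case: (zsol n).
  have hX : hausdorff_space X by exact: metric_hausdorff.
  exact: (cvg_unique hX (xi_lim 0 (lexx _)) base0).
move=> t x pt xsol _ mesh0 T P /uniform_nbhs[E [+ EP]].
rewrite -entourage_ballE => -[eps /= eps0 epsE].
have [delta d0 hd] := xi_close T eps eps0.
have : \forall i \near \oo, (mesh (t i) < delta%:E)%E.
  apply: (mesh0 [set u | (u < delta%:E)%E]).
  by apply: open_ereal_lt'; rewrite lte_fin.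
apply: filterS => i mi; apply: EP => u; rewrite /= in_itv /= => uT.
apply: epsE; rewrite /= ballEmdist /=; apply: hd => // k.
rewrite -lee_fin (le_trans _ (ltW mi))//.
by apply: ereal_sup_ubound; exists k.
Unshelve. all: by end_near. Qed.
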